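(* Let $A$, $B$, $C$ be $m \times n$ matrices over $\{-1,0,1\}$ such that $A$ has at least one entry equal to $0$. If none of $A$, $B$, $C$ is a layered matrix, then ${\rm IST}(A,B,C)$ is finite.
   Context: For an $m\times n$ matrix $M=[m_{ij}]$ over $\{-1,0,1\}$, $G_o(M)$ denotes the directed graph on vertex set $\{1,\dots,n+m\}$ with an edge $j\to i$ for all $1\le j<i\le n$, and, for each $1\le p\le m$ and $1\le j\le n$, an edge $j\to n+p$ if $m_{pj}=1$, an edge $n+p\to j$ if $m_{pj}=-1$, and no edge between $j$ and $n+p$ if $m_{pj}=0$; there are no edges among the vertices $n+1,\dots,n+m$. A directed graph (no loops or multiple edges) is semi-transitive if it is acyclic and for every directed path $u_1\to u_2\to\cdots\to u_t$ with $t\ge 2$, either there is no edge $u_1\to u_t$ or all edges $u_i\to u_j$ exist for $1\le i<j\le t$. Given $m\times n$ matrices $A,B,C$ over $\{-1,0,1\}$, let $\varphi$ be the 2-dimensional morphism replacing every entry $0$ by the block $A$, every entry $1$ by the block $B$ and every entry $-1$ by the block $C$; $M^k(A,B,C)=\varphi^k([0])$ (so $M^0=[0]$ and $M^k$ is $m^k\times n^k$), and $G_o^k(A,B,C)=G_o(M^k(A,B,C))$. When $A$ has an entry $0$, the index of semi-transitivity ${\rm IST}(A,B,C)$ is the smallest integer $\ell\ge 0$ such that $G_o^\ell(A,B,C)$ is not semi-transitive, and ${\rm IST}(A,B,C)=\infty$ if no such $\ell$ exists. A matrix is layered if all entries in the same row are identical. *)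

(* Defs.v *)
From HB Require Import structures.
From mathcomp Require Import all_boot all_order all_algebra.
From mathcomp Require Import boolp.
From mathcomp.real_closed Require Import mxtens.

Set Implicit Arguments.
Unset Strict Implicit.
Unset Printing Implicit Defensive.

(* The alphabet {-1, 0, 1}. *)
Inductive entry := Neg | Zero | Pos.

Definition entry_code (a : entry) : option bool :=
  match a with Neg => Some false | Zero => None | Pos => Some true end.
Definition entry_decode (c : option bool) : entry :=
  match c with Some false => Neg | None => Zero | Some true => Pos end.
Lemma entry_codeK : cancel entry_code entry_decode.
Proof. by case. Qed.
HB.instance Definition _ := Finite.copy entry (can_type entry_codeK).

Definition layered (m n : nat) (M : 'M[entry]_(m, n)) : Prop :=
  forall (i : 'I_m) (j j' : 'I_n), M i j = M i j'.

(* The vertex set {1, ..., n + m} is shifted to 'I_(n + m): [inl j] is the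
   vertex j + 1 and [inr p] is the vertex n + p + 1. *)
Definition Go (m n : nat) (M : 'M[entry]_(m, n)) : rel 'I_(n + m) :=
  fun u v =>
    match split u, split v with
    | inl j, inl i => (j < i)%N
    | inl j, inr p => M p j == Pos
    | inr p, inl j => M p j == Neg
    | inr _, inr _ => false
    end.

Definition acyclic (V : eqType) (e : rel V) : Prop :=
  forall c : seq V, c != [::] -> ~~ cycle e c.

(* A directed path u_1 -> ... -> u_t is [u :: p] with [path e u p]. The case
   t = 1 is vacuous, since [pairwise] only constrains positions i < j. *)
Definition semi_transitive (V : eqType) (e : rel V) : Prop :=
  acyclic e /\
  forall (u : V) (p : seq V),
    path e u p -> ~~ e u (last u p) \/ pairwise e (u :: p).

Definition block (m n : nat) (A B C : 'M[entry]_(m, n)) (a : entry) :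
    'M[entry]_(m, n) :=
  match a with Zero => A | Pos => B | Neg => C end.

(* [mxtens_unindex] is Euclidean division: row i of the image lies in the row
   of blocks i %/ m, at row i %% m of these blocks; likewise for columns. *)
Definition morphism (m n : nat) (A B C : 'M[entry]_(m, n))
    (p q : nat) (X : 'M[entry]_(p, q)) :
    'M[entry]_(p * m, q * n) :=
  \matrix_(i, j)
    let: (i1, i2) := mxtens_unindex i in
    let: (j1, j2) := mxtens_unindex j in
    block A B C (X i1 j1) i2 j2.

Fixpoint Mk (m n : nat) (A B C : 'M[entry]_(m, n)) (k : nat) :
    'M[entry]_(m ^ k, n ^ k) :=
  match k with
  | 0 => const_mx Zero
  | k'.+1 =>
      castmx (esym (expnSr m k'), esym (expnSr n k'))
        (morphism A B C (Mk A B C k'))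
  end.

Definition Gok (m n : nat) (A B C : 'M[entry]_(m, n)) (k : nat) :
    rel 'I_(n ^ k + m ^ k) :=
  Go (Mk A B C k).
Arguments Gok {m n} A B C k.

Definition not_st (m n : nat) (A B C : 'M[entry]_(m, n)) (k : nat) : bool :=
  `[< ~ semi_transitive (Gok A B C k) >].

(* [None] stands for infinity. *)
Definition IST (m n : nat) (A B C : 'M[entry]_(m, n)) : option nat :=
  match pselect (exists k, not_st A B C k) with
  | left h => Some (ex_minn h)
  | right _ => None
  end.

(* Main.v *)
(* A nonconstant word repeated twice contains a subsequence x y x y with x <> y,
   and whatever x and y are, such a pattern in a row of M destroys the
   semi-transitivity of Go M. Hence, as no block is layered, a repeated letter
   in a row of M^k makes M^(k+1) violate semi-transitivity. Since n >= 2, the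
   rows of M^2 have length n^2 >= 4 > 3, so a letter is repeated there, and
   M^3 is never semi-transitive. *)
Require Import Defs.
From mathcomp Require Import all_boot all_order all_algebra.
From mathcomp Require Import boolp.
From mathcomp.real_closed Require Import mxtens.

Set Implicit Arguments.
Unset Strict Implicit.
Unset Printing Implicit Defensive.

Section ForbiddenPatterns.
Variables (m n : nat) (M : 'M[entry]_(m, n)).
Hypothesis stM : semi_transitive (Go M).

Lemma Go_ll (i j : 'I_n) : Go M (lshift m i) (lshift m j) = (i < j)%N.
Proof. by rewrite /Go !(unsplitK (inl _)). Qed.

Lemma Go_lr (j : 'I_n) (p : 'I_m) :
  Go M (lshift m j) (rshift n p) = (M p j == Pos).
Proof. by rewrite /Go (unsplitK (inl _)) (unsplitK (inr _)). Qed.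

Lemma Go_rl (p : 'I_m) (j : 'I_n) :
  Go M (rshift n p) (lshift m j) = (M p j == Neg).
Proof. by rewrite /Go (unsplitK (inl _)) (unsplitK (inr _)). Qed.

Definition GoE := (Go_ll, Go_lr, Go_rl).

(** The vertices [rshift n p], [i], [j] would form a directed triangle. *)
Lemma no_Neg_Pos (p : 'I_m) (i j : 'I_n) :
  (i < j)%N -> M p i = Neg -> M p j = Pos -> False.
Proof.
move=> ltij Mi Mj.
have := stM.1 [:: rshift n p; lshift m i; lshift m j] isT.
by rewrite /= !GoE ltij Mi Mj !eqxx.
Qed.

(** The path from [i] through [j] and [k] to [rshift n p] has its shortcutting edge from [i], but
    the zero removes the edge from [j] to [rshift n p]. *)
Lemma no_Pos_Zero_Pos (p : 'I_m) (i j k : 'I_n) :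
  (i < j)%N -> (j < k)%N -> M p i = Pos -> M p j = Zero -> M p k = Pos -> False.
Proof.
move=> ltij ltjk Mi Mj Mk; have neq : (Zero == Pos) = false by [].
have := stM.2 (lshift m i) [:: lshift m j; lshift m k; rshift n p].
by rewrite /= !GoE ltij ltjk Mi Mj Mk neq !eqxx /= ?andbF => /(_ isT) [].
Qed.

(** Dual to the previous pattern: the path now starts at [rshift n p], and its missing edge is the
    one to [j]. *)
Lemma no_Neg_Zero_Neg (p : 'I_m) (i j k : 'I_n) :
  (i < j)%N -> (j < k)%N -> M p i = Neg -> M p j = Zero -> M p k = Neg -> False.
Proof.
move=> ltij ltjk Mi Mj Mk; have neq : (Zero == Neg) = false by [].
have := stM.2 (rshift n p) [:: lshift m i; lshift m j; lshift m k].
by rewrite /= !GoE ltij ltjk Mi Mj Mk neq !eqxx /= ?andbF => /(_ isT) [].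
Qed.

Lemma no_alternation (p : 'I_m) (j1 j2 j3 j4 : 'I_n) :
  (j1 < j2)%N -> (j2 < j3)%N -> (j3 < j4)%N ->
  M p j1 = M p j3 -> M p j2 = M p j4 -> M p j1 = M p j2.
Proof.
move=> lt12 lt23 lt34.
(* Each of the six ordered pairs of distinct letters [x], [y] makes the word [x y x y] contain one
   of the three forbidden patterns. *)
case E1: (M p j1); case E2: (M p j2) => // /esym E3 /esym E4; exfalso.
- exact: no_Neg_Zero_Neg lt12 lt23 E1 E2 E3.
- exact: no_Neg_Pos lt12 E1 E2.
- exact: no_Neg_Zero_Neg lt23 lt34 E2 E3 E4.
- exact: no_Pos_Zero_Pos lt23 lt34 E2 E3 E4.
- exact: no_Neg_Pos lt23 E2 E3.
- exact: no_Pos_Zero_Pos lt12 lt23 E1 E2 E3.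
Qed.

End ForbiddenPatterns.

Lemma nonlayeredP (m n : nat) (X : 'M[entry]_(m, n)) :
  ~ layered X ->
  exists (i : 'I_m) (a b : 'I_n), (a < b)%N /\ X i a <> X i b.
Proof.
move=> /existsNP[i /existsNP[a /existsNP[b Xab]]].
case: (ltngtP a b) => [ltab|ltba|/val_inj eqab].
- by exists i, a, b.
- by exists i, b, a; split => // /esym.
- by rewrite eqab in Xab.
Qed.

Lemma entry_repeats (N : nat) (f : 'I_N -> entry) :
  (3 < N)%N -> exists i j : 'I_N, (i < j)%N /\ f i = f j.
Proof.
move=> gtN3.
have /injectivePn[i [j neqij eqf]] : ~~ injectiveb f.
  apply/negP => /injectiveP injf.
  (* Pigeonhole: an injective [f] would embed ['I_N] into [option bool], which has three
     elements. *)
  have := leq_card (entry_code \o f) (inj_comp (can_inj entry_codeK) injf).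
  by rewrite card_ord card_option card_bool leqNgt gtN3.
case: (ltngtP i j) => [ltij|ltji|/val_inj eqij].
- by exists i, j.
- by exists j, i.
- by rewrite eqij eqxx in neqij.
Qed.

Section Powers.
Variables (m n : nat) (A B C : 'M[entry]_(m, n)).

(** Offset [r] inside block [i], that is [i * d + r]; the cast matches the one in [Mk]. *)
Definition Mk_index (d k : nat) (i : 'I_(d ^ k)) (r : 'I_d) : 'I_(d ^ k.+1) :=
  cast_ord (esym (expnSr d k)) (mxtens_index (i, r)).

Lemma Mk_indexE (k : nat) (i : 'I_(m ^ k)) (r : 'I_m)
    (j : 'I_(n ^ k)) (c : 'I_n) :
  Mk A B C k.+1 (Mk_index i r) (Mk_index j c)
  = block A B C (Mk A B C k i j) r c.
Proof. by rewrite /= castmxE !esymK !cast_ordKV mxE !mxtens_indexK. Qed.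

Lemma Mk_index_lt_low (d k : nat) (i : 'I_(d ^ k)) (r s : 'I_d) :
  (r < s)%N -> (Mk_index i r < Mk_index i s)%N.
Proof. by move=> ltrs; rewrite /= ltn_add2l. Qed.

Lemma Mk_index_lt_high (d k : nat) (i j : 'I_(d ^ k)) (r s : 'I_d) :
  (i < j)%N -> (Mk_index i r < Mk_index j s)%N.
Proof.
move=> ltij /=; apply: (@leq_trans (i.+1 * d)); last first.
  by apply: leq_trans (leq_addr _ _); rewrite leq_mul2r ltij orbT.
by rewrite mulSn addnC ltn_add2r.
Qed.

Hypotheses (nlA : ~ layered A) (nlB : ~ layered B) (nlC : ~ layered C).

Lemma nonlayered_block (x : entry) : ~ layered (block A B C x).
Proof. by case: x. Qed.

Lemma repetition_not_st (k : nat) (p : 'I_(m ^ k)) (i j : 'I_(n ^ k)) :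
  (i < j)%N -> Mk A B C k p i = Mk A B C k p j ->
  ~ semi_transitive (Gok A B C k.+1).
Proof.
move=> ltij eqij st.
have [r [a [b [ltab]]]] :=
  nonlayeredP (@nonlayered_block (Mk A B C k p i)).
rewrite -!Mk_indexE; apply.
(* Blocks [i] and [j] of block row [p] coincide, so row [r] of them reads [x y] at offsets [a], [b]
   in block [i] and again in block [j]. *)
by apply: (no_alternation st (Mk_index_lt_low _ ltab)
  (Mk_index_lt_high _ _ ltij) (Mk_index_lt_low _ ltab));
  rewrite !Mk_indexE eqij.
Qed.

Lemma Mk3_not_st : ~ semi_transitive (Gok A B C 3).
Proof.
have [r [a [b [ltab _]]]] := nonlayeredP nlA.
have n_gt1 : (1 < n)%N by apply: leq_ltn_trans (ltn_ord b); case: (b : nat) ltab.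
(* Any row would do; row 0 exists because the index [r] forces [m] to be positive. *)
have p : 'I_(m ^ 2).
  by apply: (@Ordinal _ 0); rewrite expn_gt0 (leq_ltn_trans _ (ltn_ord r)).
(* By computation the goal is [2 ^ 2 <= n ^ 2]. *)
have n2_gt3 : (3 < n ^ 2)%N by rewrite (@leq_exp2r 2 n 2).
have [i [j [ltij eqij]]] := entry_repeats (Mk A B C 2 p) n2_gt3.
exact: repetition_not_st ltij eqij.
Qed.

End Powers.

Theorem theorem3p10 (m n : nat) (A B C : 'M[entry]_(m, n))
  (hA : exists (i : 'I_m) (j : 'I_n), A i j = Zero)
  (nlA : ~ layered A) (nlB : ~ layered B) (nlC : ~ layered C) :
  exists l : nat, IST A B C = Some l.
Proof.
rewrite /IST; case: pselect => [h|[]]; first by exists (ex_minn h).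
by exists 3; apply/asboolP/Mk3_not_st.
Qed.
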